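(* Let $G$ be a finite group with $|G|\ge2$ and let $\mu$ be a probability measure on $G$ such that the transition matrix $P_\mu(x,y)=\mu(x^{-1}\cdot y)$, $x,y\in G$, is irreducible and aperiodic. Let $\Gamma=\{x\in G:\mu(x)>0\}$ and $\Gamma^{-1}=\{x^{-1}:x\in\Gamma\}$. If $\langle\Gamma\cdot\Gamma^{-1}\rangle=G$, then there exist constants $C=C(G,\mu)>0$ and $\rho=\rho(G,\mu)\in(0,1)$ such that for every $\alpha\in[0,1)$ and every $n\ge1$, the SRRW $S$ on $G$ with step distribution $\mu$ and reinforcement parameter $\alpha$ satisfies $$d_\infty(n):=\max_{x\in G}\big|\,|G|\cdot\mathbb{P}(S_n=x)-1\big|\le C\rho^{(1-\alpha)n}.$$ In particular, this holds in each of the following cases: (i) $\Gamma$ is symmetric, i.e. $\Gamma=\Gamma^{-1}$; (ii) $\Gamma$ is a union of conjugacy classes of $G$ (which contains the case when $G$ is abelian); (iii) $e_G\in\Gamma$.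
   Context: SRRW: Let $(G,\cdot)$ be a discrete group with $|G|\ge2$ and identity $e_G$, $\mu$ a probability measure on $G$, and $\alpha\in[0,1)$. Let $(\xi_n)_{n\ge2}$ be i.i.d. Bernoulli random variables with $\mathbb{P}(\xi_n=1)=\alpha$, and let $(u_n)_{n\ge2}$ be independent with $u_n$ uniform on $\{1,\dots,n-1\}$; these two sequences and all fresh samples from $\mu$ below are independent. Set $S_0=e_G$; sample $X_1$ from $\mu$ and set $S_1=X_1$. For $n>1$: if $\xi_n=1$ set $X_n=X_{u_n}$; if $\xi_n=0$ sample $X_n$ afresh from $\mu$; put $S_n=S_{n-1}\cdot X_n$. The process $(S_n)$ is the SRRW on $G$ (started at $e_G$) with step distribution $\mu$ and reinforcement parameter $\alpha$. For subsets $A,B\subset G$, $A\cdot B=\{a\cdot b:a\in A,b\in B\}$, and $\langle A\rangle$ is the subgroup generated by $A$ (for $A\neq\emptyset$). *)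

(* Defs.v *)
From HB Require Import structures.
From mathcomp Require Import all_boot all_order all_algebra all_fingroup.
From mathcomp Require Import all_classical all_reals all_analysis.

Set Implicit Arguments.
Unset Strict Implicit.
Unset Printing Implicit Defensive.

Import Order.TTheory GRing.Theory Num.Theory.
Local Open Scope ring_scope.

Section MarkovChains.
Variables (R : realType) (m : nat).
Implicit Type Q : 'M[R]_m.

Definition irreducible_chain Q : Prop :=
  forall i j : 'I_m, exists n : nat, 0 < (Q ^+ n) i j.

(* Says that gcd {n >= 1 : Q^n(i,i) > 0} = 1 for every state i.
   When that set is empty every d is a common divisor, so i is not aperiodic. *)
Definition aperiodic_chain Q : Prop :=
  forall (i : 'I_m) (d : nat),
    (forall n : nat, (0 < n)%N -> 0 < (Q ^+ n) i i -> (d %| n)%N) -> d = 1%N.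

End MarkovChains.

Section StepDistribution.
Variables (R : realType) (gT : finGroupType).
Implicit Type mu : gT -> R.

Definition is_prob_mass mu : Prop :=
  (forall x, 0 <= mu x) /\ \sum_(x : gT) mu x = 1.

(* The states of the chain are the elements of the group, numbered through
   [enum_val : 'I_#|gT| -> gT]. *)
Definition transition_mx mu : 'M[R]_#|gT| :=
  \matrix_(i, j) mu ((enum_val i)^-1 * enum_val j)%g.

Definition pmf_supp mu : {set gT} := [set x : gT | 0 < mu x]%SET.

Definition union_of_classes (A : {set gT}) : Prop :=
  exists K : {set {set gT}}, K \subset classes [set: gT]%SET /\ A = finset.cover K.

End StepDistribution.

Section DiscreteRandomVariables.
Context (R : realType) (d : measure_display) (Om : measurableType d)
  (P : probability Om R).

(* Codomains carry the discrete sigma-algebra: every subset is measurable. *)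
Definition discrete_rv (T : Type) (X : Om -> T) : Prop :=
  forall A : set T, measurable (X @^-1` A)%classic.

Definition mutually_independent (I : eqType) (T : I -> Type)
    (X : forall i, Om -> T i) : Prop :=
  forall (s : seq I) (A : forall i, set (T i)), uniq s ->
    P (\bigcap_(i in [set` s]) (X i @^-1` A i))%classic
    = (\prod_(i <- s) P (X i @^-1` A i)%classic)%E.

End DiscreteRandomVariables.

Section SRRW.
Context (R : realType) (d : measure_display) (Om : measurableType d)
  (P : probability Om R) (gT : finGroupType).

(* One heterogeneous family collecting the coins xi_n (n >= 2), the uniform
   times u_n (n >= 2) and the fresh samples eta_n (n >= 1). *)
Definition noise_val (i : nat + nat + nat) : Type :=
  match i with
  | inl (inl _) => bool
  | inl (inr _) => nat
  | inr _ => gT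
  end.

Definition noise (xi : nat -> Om -> bool) (u : nat -> Om -> nat)
    (eta : nat -> Om -> gT) (i : nat + nat + nat) : Om -> noise_val i :=
  match i with
  | inl (inl k) => xi k.+2
  | inl (inr k) => u k.+2
  | inr k => eta k.+1
  end.

(* The fresh samples are realised by an i.i.d. sequence eta of law mu; eta_n is
   read only when n = 1 or xi_n = 0.  The values of xi, u, eta and X at indices
   below their natural range play no role. *)
Record is_SRRW_from (mu : gT -> R) (alpha : R)
    (xi : nat -> Om -> bool) (u : nat -> Om -> nat) (eta : nat -> Om -> gT)
    (X S : nat -> Om -> gT) : Prop := {
  coin_rv : forall n, (2 <= n)%N -> discrete_rv (xi n);
  coin_law : forall n, (2 <= n)%N ->
    P [set w | xi n w = true]%classic = alpha%:E;
  time_rv : forall n, (2 <= n)%N -> discrete_rv (u n);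
  time_range : forall n w, (2 <= n)%N -> (1 <= u n w < n)%N;
  time_law : forall n k, (2 <= n)%N -> (1 <= k < n)%N ->
    P [set w | u n w = k]%classic = ((n.-1)%:R^-1)%:E;
  fresh_rv : forall n, (1 <= n)%N -> discrete_rv (eta n);
  fresh_law : forall n x, (1 <= n)%N ->
    P [set w | eta n w = x]%classic = (mu x)%:E;
  noise_indep : mutually_independent P (noise xi u eta);
  first_step : forall w, X 1%N w = eta 1%N w;
  next_step : forall n w, (2 <= n)%N ->
    X n w = if xi n w then X (u n w) w else eta n w;
  walk_start : forall w, S 0%N w = 1%g;
  walk_step : forall n w, S n.+1 w = (S n w * X n.+1 w)%g
}.

Definition is_SRRW (mu : gT -> R) (alpha : R) (S : nat -> Om -> gT) : Prop :=
  exists (xi : nat -> Om -> bool) (u : nat -> Om -> nat)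
         (eta : nat -> Om -> gT) (X : nat -> Om -> gT),
    is_SRRW_from mu alpha xi u eta X S.

(* The terms are nonnegative, so the default value 0 does not affect the max. *)
Definition d_infty (S : nat -> Om -> gT) (n : nat) : R :=
  \big[Num.max/0]_(x : gT)
    `| #|gT|%:R * fine (P [set w | S n w = x]%classic) - 1 |.

End SRRW.

(* C and rho are chosen before alpha, n and the realisation of the walk. *)
Definition SRRW_exponential_bound (R : realType) (gT : finGroupType)
    (mu : gT -> R) : Prop :=
  exists C rho : R, [/\ 0 < C, 0 < rho, rho < 1 &
    forall alpha : R, 0 <= alpha -> alpha < 1 ->
    forall (d : measure_display) (Om : measurableType d)
      (P : probability Om R) (S : nat -> Om -> gT),
    is_SRRW P mu alpha S ->
    forall n : nat, (1 <= n)%N ->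
      d_infty P S n <= C * rho `^ ((1 - alpha) * n%:R)].

(* Main.v *)
Require Import Defs.
From mathcomp Require Import all_boot all_order all_algebra all_fingroup cyclic.
From mathcomp Require Import all_classical all_reals all_analysis.
From mathcomp Require Import ring lra zify.

(** The increments of the walk copy one another, but a step of the walk that
    is fresh and is never copied afterwards is independent of everything else.
    Condition on the coins xi, on the times u and on all the samples except
    those read exactly once. What remains of S_n is a product, in a fixed
    order, of group constants and of independent letters of law mu.
    Multiplying by a constant is an isometry of L^2(G). Multiplying by a
    letter of law mu is the convolution [rconv mu], which on functions of sum
    0 shrinks the norm by a factor r < 1 as soon as the differences y z^-1 of
    points of the support generate G ([rconv_contraction]). So the conditional
    law of S_n is within r^K of the uniform value, where K is the number of
    steps fresh and never copied ([word_law_dist]).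

    It remains to bound the mean of r^K. A step that no later time u_k points
    at is counted in K as soon as its own coin says fresh, whatever the coins
    of the other steps. Given u, these coins are independent, hence the mean
    over the coins is at most s^L, with s = alpha + (1 - alpha) r, where L is
    the number of indices other than 1 that no later u_k hits
    ([coin_average]). The variable L does not depend on alpha: it is the
    number of leaves, apart from the root, of the random recursive tree with n
    nodes. Adding node n + 1 to the tree creates a leaf, and destroys one with
    conditional probability L / n, so that

      E s^(L_(n+1)) = E [s^L (s + (1 - s) L / n)],      E L_n <= n / 2.

    As s^L decreases with L, these two variables are negatively correlated,
    which gives ([Etree_pow])

      E s^(L_(n+1)) <= (1 + s)/2 * E s^(L_n).

    Here (1 + s)/2 = 1 - (1 - alpha)(1 - r)/2 <= rho^(1 - alpha), where
    rho = exp (- (1 - r)/2).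

    In each of the three special cases the support normalises the subgroup H
    generated by the differences, or lies in H. When the support normalises H,
    it lies in a single coset of H, whose order in the quotient divides every
    return time of the chain; aperiodicity makes that order 1, and
    irreducibility then gives H = G ([diff_gen_of_norm]). *)

Set Implicit Arguments.
Unset Strict Implicit.
Unset Printing Implicit Defensive.
(* Names such as [subsetP] or [set0] refer to finite sets below. *)
Import mathcomp.boot.fintype mathcomp.boot.finset.
Import Order.TTheory GRing.Theory Num.Theory.
Local Open Scope ring_scope.

(** * Expectations over finitely many independent coordinates *)

Section ProductExpectation.
Variables (R : realType) (I T : finType) (p : I -> T -> R).
Hypothesis p_ge0 : forall i t, 0 <= p i t.
Hypothesis p_sum1 : forall i, \sum_t p i t = 1.

Definition pexp (Phi : {ffun I -> T} -> R) : R :=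
  \sum_(f : {ffun I -> T}) (\prod_i p i (f i)) * Phi f.

Lemma eq_pexp Phi Psi : Phi =1 Psi -> pexp Phi = pexp Psi.
Proof. by move=> e; apply: eq_bigr => f _; rewrite e. Qed.

(** Only points of nonzero weight matter: this is how the almost sure
    constraints on the times are used later. *)
Lemma le_pexp (Phi Psi : {ffun I -> T} -> R) :
    (forall f : {ffun I -> T}, (forall i, p i (f i) != 0) -> Phi f <= Psi f) ->
  pexp Phi <= pexp Psi.
Proof.
move=> le; apply: ler_sum => f _.
case: (eqVneq (\prod_i p i (f i)) 0) => [->|nz]; first by rewrite !mul0r.
apply: ler_wpM2l; first exact: prodr_ge0.
by apply: le => i; move/prodf_neq0: nz; apply.
Qed.

Lemma pexpZ a Phi : pexp (fun f => a * Phi f) = a * pexp Phi.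
Proof. by rewrite /pexp mulr_sumr; apply: eq_bigr => f _; rewrite mulrCA. Qed.

Lemma pexpD Phi Psi : pexp (fun f => Phi f + Psi f) = pexp Phi + pexp Psi.
Proof. by rewrite /pexp -big_split; apply: eq_bigr => f _; rewrite mulrDr. Qed.

Lemma pexp_sum (J : finType) (Phi : J -> {ffun I -> T} -> R) :
  pexp (fun f => \sum_j Phi j f) = \sum_j pexp (Phi j).
Proof.
by rewrite /pexp exchange_big; apply: eq_bigr => f _; rewrite mulr_sumr.
Qed.

Lemma pexp_prod (h : I -> T -> R) :
  pexp (fun f => \prod_i h i (f i)) = \prod_i \sum_t p i t * h i t.
Proof.
rewrite bigA_distr_bigA; apply: eq_bigr => f _.
by rewrite -big_split.
Qed.

Lemma pexp_cst a : pexp (fun=> a) = a.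
Proof.
rewrite -[a in LHS]mulr1 pexpZ.
have := pexp_prod (fun _ _ => 1); rewrite (@eq_pexp _ (fun=> 1)); last first.
  by move=> f; rewrite big1.
move=> ->; rewrite big1 ?mulr1// => i _.
by under eq_bigr do rewrite mulr1.
Qed.

Lemma norm_pexp Phi : `|pexp Phi| <= pexp (fun f => `|Phi f|).
Proof.
apply: (le_trans (ler_norm_sum _ _ _)); apply: ler_sum => f _.
by rewrite normrM ger0_norm ?prodr_ge0.
Qed.

Lemma pexp_coord i (h : T -> R) : pexp (fun f => h (f i)) = \sum_t p i t * h t.
Proof.
have := pexp_prod (fun j t => if j == i then h t else 1).
rewrite (@eq_pexp _ (fun f => h (f i))); last first.
  move=> f; rewrite (bigD1 i)//= eqxx big1 ?mulr1// => j /negbTE ji.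
  by rewrite ji.
move=> ->; rewrite (bigD1 i)//= [X in _ * X]big1 ?mulr1; last first.
  by move=> j /negbTE ji; under eq_bigr do rewrite ji mulr1.
by under eq_bigr do rewrite eqxx.
Qed.

(** [splice A f f'] reads [f'] on [A] and [f] elsewhere. *)
Definition splice (A : {set I}) (f f' : {ffun I -> T}) : {ffun I -> T} :=
  [ffun i => if i \in A then f' i else f i].

(** Conditioning on the coordinates outside [A]: those inside [A] may be
    replaced by an independent copy, because exchanging the two families on [A]
    is an involution of the pairs [(f, f')] that preserves the product
    weight. *)
Lemma pexp_splice A Phi :
  pexp Phi = pexp (fun f => pexp (fun f' => Phi (splice A f f'))).
Proof.
transitivity (\sum_(q : {ffun I -> T} * {ffun I -> T})
    (\prod_i p i (q.1 i) * \prod_i p i (q.2 i)) * Phi q.1).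
  rewrite -(pair_bigA _ (fun f f' : {ffun I -> T} =>
    (\prod_i p i (f i) * \prod_i p i (f' i)) * Phi f))/=.
  apply: eq_bigr => f _; rewrite -[Phi f in LHS]pexp_cst -[LHS]pexpZ.
  apply: eq_bigr => f' _; ring.
pose sw (q : {ffun I -> T} * {ffun I -> T}) :=
  (splice A q.1 q.2, splice A q.2 q.1).
have swK : involutive sw.
  case=> f f'; rewrite /sw /=.
  by congr pair; apply/ffunP => i; rewrite !ffunE; case: (i \in A).
rewrite (reindex_inj (inv_inj swK)) /pexp /=.
transitivity (\sum_(f : {ffun I -> T}) \sum_(f' : {ffun I -> T})
    (\prod_i p i (f i) * \prod_i p i (f' i)) * Phi (splice A f f')); last first.
  by apply: eq_bigr => f _; rewrite mulr_sumr; apply: eq_bigr => f' _; ring.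
rewrite pair_bigA; apply: eq_bigr => -[f f'] _ /=; congr (_ * _).
rewrite -!big_split; apply: eq_bigr => i _; rewrite !ffunE /=.
by case: ifP => //; rewrite mulrC.
Qed.

Definition upd (f : {ffun I -> T}) i t : {ffun I -> T} :=
  [ffun j => if j == i then t else f j].

(** Integrating one coordinate first. *)
Lemma pexp_resample i Phi :
  pexp Phi = pexp (fun f => \sum_t p i t * Phi (upd f i t)).
Proof.
rewrite (pexp_splice [set i]%SET); apply: eq_pexp => f.
rewrite -(pexp_coord i (fun t => Phi (upd f i t))); apply: eq_pexp => f'.
congr Phi; apply/ffunP => j; rewrite !ffunE finset.in_set1.
by case: eqP => // ->.
Qed.

End ProductExpectation.

(** * Contraction of the convolution *)

Section Contraction.
Variables (R : realType) (gT : finGroupType) (mu : gT -> R).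
Hypothesis hmu : is_prob_mass mu.
Let Gam := pmf_supp mu.

Lemma mu_ge0 x : 0 <= mu x. Proof. by case: hmu. Qed.
Lemma mu_sum1 : \sum_x mu x = 1. Proof. by case: hmu. Qed.

(** The density, for the counting measure, of the product of an element of
    density [f] by an independent letter of law [mu] on its right. *)
Definition rconv (f : gT -> R) (x : gT) : R := \sum_y mu y * f (x * y^-1)%g.
Definition sqnorm (f : gT -> R) : R := \sum_x f x ^+ 2.
Definition disp (f : gT -> R) (s : gT) : R := \sum_x (f x - f (x * s)%g) ^+ 2.

Lemma sqnorm_ge0 f : 0 <= sqnorm f.
Proof. by apply: sumr_ge0 => x _; exact: sqr_ge0. Qed.

Lemma disp_ge0 f s : 0 <= disp f s.
Proof. by apply: sumr_ge0 => x _; exact: sqr_ge0. Qed.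

Lemma sum_shift (F : gT -> R) s : \sum_x F (x * s)%g = \sum_x F x.
Proof. by rewrite [RHS](reindex_inj (mulIg s)). Qed.

Lemma dispE f s : disp f s = 2 * sqnorm f - 2 * \sum_x f x * f (x * s)%g.
Proof.
rewrite {1}mulr_natl mulr2n -{2}[sqnorm f](sum_shift (fun x => f x ^+ 2) s).
rewrite /sqnorm -big_split /= mulr_sumr -sumrB; apply: eq_bigr => x _; ring.
Qed.

Lemma sqnorm_rconv f :
  sqnorm (rconv f) =
  \sum_y \sum_z mu y * mu z * \sum_x f x * f (x * (y * z^-1))%g.
Proof.
transitivity (\sum_x \sum_y \sum_z
    mu y * mu z * (f (x * y^-1)%g * f (x * z^-1)%g)).
  apply: eq_bigr => x _; rewrite expr2 /rconv mulr_suml; apply: eq_bigr => y _.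
  by rewrite mulr_sumr; apply: eq_bigr => z _; ring.
rewrite exchange_big; apply: eq_bigr => y _.
rewrite exchange_big; apply: eq_bigr => z _.
rewrite -mulr_sumr; congr (_ * _).
rewrite -(sum_shift _ y); apply: eq_bigr => x _.
by rewrite mulgK mulgA.
Qed.

(** The energy lost by convolution is a Dirichlet form: the adjoint of
    [rconv mu] composed with [rconv mu] is the convolution by the law of
    [y * z^-1], with [y] and [z] independent of law [mu]. *)
Lemma rconv_gap f :
  2 * (sqnorm f - sqnorm (rconv f)) =
  \sum_y \sum_z mu y * mu z * disp f (y * z^-1)%g.
Proof.
have -> : 2 * (sqnorm f - sqnorm (rconv f)) =
    \sum_y \sum_z mu y * mu z * (2 * sqnorm f) - 2 * sqnorm (rconv f).
  rewrite (eq_bigr (fun y => mu y * (2 * sqnorm f))); last first.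
    by move=> y _; rewrite -mulr_suml -mulr_sumr mu_sum1 mulr1.
  by rewrite -mulr_suml mu_sum1; ring.
rewrite sqnorm_rconv [X in _ - X]mulr_sumr -sumrB; apply: eq_bigr => y _.
rewrite [X in _ - X]mulr_sumr -sumrB; apply: eq_bigr => z _.
by rewrite dispE; ring.
Qed.

Lemma rconv_gap_ge0 f : 0 <= sqnorm f - sqnorm (rconv f).
Proof.
have : 0 <= 2 * (sqnorm f - sqnorm (rconv f)); last by lra.
rewrite rconv_gap; apply: sumr_ge0 => y _; apply: sumr_ge0 => z _.
by rewrite !mulr_ge0 ?mu_ge0 ?disp_ge0.
Qed.

Lemma dispM f s t : disp f (s * t)%g <= 2 * disp f s + 2 * disp f t.
Proof.
rewrite -[disp f t](sum_shift (fun x => (f x - f (x * t)%g) ^+ 2) s).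
rewrite !mulr_sumr -big_split /=; apply: ler_sum => x _.
rewrite !mulgA; move: (f x) (f (x * s)%g) (f (x * s * t)%g) => a b c.
by have := sqr_ge0 (a - b - (b - c)); lra.
Qed.

(** Averaged over all shifts, a function of sum 0 is orthogonal to its
    translates. *)
Lemma sum_disp f : \sum_x f x = 0 ->
  \sum_s disp f s = 2 * #|gT|%:R * sqnorm f.
Proof.
move=> f0; under eq_bigr do rewrite dispE.
rewrite sumrB sumr_const -mulr_sumr -mulr_natl.
suff -> : \sum_s \sum_x f x * f (x * s)%g = 0 by ring.
rewrite exchange_big big1// => x _; rewrite -mulr_sumr.
have -> : \sum_s f (x * s)%g = 0.
  by rewrite -[RHS]f0 [RHS](reindex_inj (mulgI x)).
by rewrite mulr0.
Qed.

(** The shifts for which a Poincare inequality holds, with a constant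
    independent of the function.  By [dispM] they form a subgroup. *)
Definition gap_controls (s : gT) : Prop :=
  exists2 c : R, 0 <= c &
    forall f, disp f s <= c * (sqnorm f - sqnorm (rconv f)).

Lemma gap_controls_gen s : s \in (Gam * Gam^-1)%g -> gap_controls s.
Proof.
case/mulsgP => y z'; rewrite !inE => y0 z0 ->.
have [z -> {z'} z0] : exists2 z, z' = (z^-1)%g & 0 < mu z.
  by exists (z'^-1)%g; rewrite ?invgK.
exists (2 / (mu y * mu z)) => [|f]; first by rewrite divr_ge0 ?mulr_ge0 ?ltW.
have yz0 : 0 < mu y * mu z by exact: mulr_gt0.
rewrite mulrAC ler_pdivlMr// rconv_gap mulrC.
rewrite (bigD1 y)//= (bigD1 z)//= -addrA lerDl addr_ge0//.
  by apply: sumr_ge0 => *; rewrite !mulr_ge0 ?mu_ge0 ?disp_ge0.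
apply: sumr_ge0 => *; apply: sumr_ge0 => *.
by rewrite !mulr_ge0 ?mu_ge0 ?disp_ge0.
Qed.

Lemma gap_controls1 : gap_controls 1%g.
Proof.
exists 0 => // f; rewrite mul0r /disp big1// => x _.
by rewrite mulg1 subrr expr0n.
Qed.

Lemma gap_controlsM s t :
  gap_controls s -> gap_controls t -> gap_controls (s * t)%g.
Proof.
move=> [c c0 Hc] [e e0 He]; exists (2 * c + 2 * e) => [|f].
  by rewrite addr_ge0 ?mulr_ge0.
apply: (le_trans (dispM _ _ _)); have := Hc f; have := He f; lra.
Qed.

Lemma gap_controls_all s :
  <<Gam * Gam^-1>>%g = [set: gT]%SET -> gap_controls s.
Proof.
move=> gen; pose H : {set gT} := [set s | `[< gap_controls s >]]%SET.
have HP x : reflect (gap_controls x) (x \in H) by rewrite inE; exact: asboolP.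
have gH : group_set H.
  apply/group_setP; split=> [|x y]; first exact/HP/gap_controls1.
  by move=> /HP hx /HP hy; apply/HP; exact: gap_controlsM.
have : <<Gam * Gam^-1>>%g \subset Group gH.
  by rewrite gen_subG; apply/subsetP => x /gap_controls_gen/HP.
by rewrite gen => /subsetP/(_ s) sH; apply/HP/sH; rewrite inE.
Qed.

(** Summing the Poincare inequalities of all shifts bounds the squared norm of a
    function of sum 0 by [K] times the energy that it loses, hence
    [r^2 = 1 - K^-1]. *)
Lemma rconv_contraction : <<Gam * Gam^-1>>%g = [set: gT]%SET ->
  exists r : R, [/\ 0 <= r, r < 1 & forall f, \sum_x f x = 0 ->
    sqnorm (rconv f) <= r ^+ 2 * sqnorm f].
Proof.
move=> gen.
have ctl s : exists c : R, 0 <= c /\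
    forall f, disp f s <= c * (sqnorm f - sqnorm (rconv f)).
  by have [c ? ?] := gap_controls_all s gen; exists c.
have [c Hc] := boolp.choice ctl.
(* The summand 1 makes K at least 1, so that 1 - K^-1 has a square root. *)
pose K := 1 + \sum_s c s.
have K1 : 1 <= K by rewrite lerDl sumr_ge0// => s _; case: (Hc s).
have K0 : 0 < K by lra.
have iK : K^-1 <= 1 by rewrite invf_le1.
have iK0 : 0 < K^-1 by rewrite invr_gt0.
exists (Num.sqrt (1 - K^-1)); split; first exact: sqrtr_ge0.
  by rewrite -[ltRHS]sqrtr1 ltr_sqrt//; lra.
move=> f f0; rewrite sqr_sqrtr; last by lra.
have N1 : 1 <= #|gT|%:R :> R.
  by rewrite ler1n; apply/card_gt0P; exists 1%g.
have : sqnorm f <= K * (sqnorm f - sqnorm (rconv f)).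
  have g0 := rconv_gap_ge0 f; have n0 := sqnorm_ge0 f.
  have h : 2 * #|gT|%:R * sqnorm f <=
      (\sum_s c s) * (sqnorm f - sqnorm (rconv f)).
    rewrite -sum_disp// mulr_suml; apply: ler_sum => s _.
    by case: (Hc s) => _; apply.
  have h2 : sqnorm f <= 2 * #|gT|%:R * sqnorm f.
    by rewrite ler_peMl//; lra.
  rewrite /K mulrDl mul1r; lra.
rewrite mulrC -ler_pdivrMr// mulrC; lra.
Qed.
End Contraction.

(** * When the differences of the support generate the group *)

Section Generation.
Variables (R : realType) (gT : finGroupType) (mu : gT -> R).
Let Gam := pmf_supp mu.
Let H : {group gT} := <<Gam * Gam^-1>>%G.
Hypothesis mu_ge0 : forall x, 0 <= mu x.

Lemma pow_transition_ge0 n i j : 0 <= (transition_mx mu ^+ n) i j.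
Proof.
elim: n i j => [|n IH] i j; first by rewrite expr0 mxE; case: eqP.
rewrite exprS mxE; apply: sumr_ge0 => k _.
by rewrite mulr_ge0// mxE.
Qed.

Lemma pow_transition_word n i j : 0 < (transition_mx mu ^+ n) i j ->
  ((enum_val i)^-1 * enum_val j)%g \in (Gam ^+ n)%g.
Proof.
elim: n i j => [|n IH] i j.
  rewrite expr0 expg0 mxE; case: eqP => [->|]; last by rewrite ltxx.
  by rewrite mulVg set11.
rewrite exprS mxE => pos.
have [k _] : exists2 k, true &
    0 < transition_mx mu i k * (transition_mx mu ^+ n) k j.
  have /existsP[k hk] :
      [exists k, 0 < transition_mx mu i k * (transition_mx mu ^+ n) k j].
    apply: contraLR pos; rewrite negb_exists => /forallP np.
    by rewrite -leNgt sumr_le0// => k _; rewrite leNgt; exact: np.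
  by exists k.
have := pow_transition_ge0 n k j; rewrite le_eqVlt => /orP[/eqP <-|kj0].
  by rewrite mulr0 ltxx.
rewrite pmulr_lgt0// mxE => ik0.
rewrite expgS; apply/mulsgP; exists ((enum_val i)^-1 * enum_val k)%g
  ((enum_val k)^-1 * enum_val j)%g; rewrite ?inE ?IH//.
by rewrite mulgA mulgK.
Qed.

Hypothesis hirr : irreducible_chain (transition_mx mu).

Lemma irreducible_gen : <<Gam>>%g = [set: gT]%SET.
Proof.
apply/eqP; rewrite finset.eqEsubset finset.subsetT; apply/subsetP => x _.
have [n] := hirr (enum_rank 1%g) (enum_rank x).
move/pow_transition_word; rewrite !enum_rankK invg1 mul1g.
apply/subsetP: x; elim: n => [|n IH]; first by rewrite expg0 sub1G.
by rewrite expgS mul_subG// subset_gen.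
Qed.

Lemma diff_gen_of_supp : Gam \subset H -> H = [set: gT]%SET :> {set gT}.
Proof.
move=> sGH; apply/eqP; rewrite finset.eqEsubset finset.subsetT.
by rewrite -irreducible_gen gen_subG.
Qed.

Hypothesis haper : aperiodic_chain (transition_mx mu).

(** All of [Gam] maps to one element of the quotient by [H], since [y * x^-1]
    lies in [H].  A return in [n] steps makes its [n]-th power trivial, so
    aperiodicity forces it to be trivial. *)
Lemma diff_gen_of_norm : Gam \subset 'N(H)%g -> H = [set: gT]%SET :> {set gT}.
Proof.
move=> nHG; apply: diff_gen_of_supp; apply/subsetP => x xG.
have nHx := subsetP nHG x xG.
have GH y : y \in Gam -> coset H y = coset H x.
  move=> yG; have nHy := subsetP nHG y yG.
  apply/eqP; rewrite eq_mulgV1 -morphV// -morphM ?groupV//.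
  by apply/eqP/coset_id/mem_gen; rewrite mem_mulg// memV_invg.
have pw n y : y \in (Gam ^+ n)%g ->
    y \in 'N(H)%g /\ coset H y = (coset H x ^+ n)%g.
  elim: n y => [|n IH] y.
    by rewrite !expg0 => /set1P ->; rewrite group1 morph1.
  rewrite !expgS => /mulsgP[a b aG bG ->].
  have [nb eb] := IH b bG; have na := subsetP nHG a aG.
  by rewrite groupM// morphM//=; split=> //; rewrite eb GH.
suff /eqP : #[coset H x]%g = 1%N.
  by rewrite order_eq1 => /eqP/coset_idr; apply.
apply: (haper (i := enum_rank 1%g)) => n _ /pow_transition_word.
rewrite mulVg => /pw[_]; rewrite morph1 => e.
by rewrite order_dvdn; apply/eqP.
Qed.

(** Conjugating by [y] in [Gam] regroups as
    [(a * b) ^ y = (y^-1 * a) * (b * y)], a product of two differences when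
    [Gam] is symmetric. *)
Lemma diff_gen_of_symmetric : Gam = Gam^-1%g -> H = [set: gT]%SET :> {set gT}.
Proof.
move=> sym; apply: diff_gen_of_norm; apply/subsetP => y yG.
apply/normP/eqP; rewrite eqEcard cardJg leqnn andbT -genJ gen_subG.
have Vy : (y^-1)%g \in Gam by rewrite sym memV_invg.
apply/subsetP => _ /imsetP[_ /mulsgP[a b aG bG ->] ->].
have -> : ((a * b) ^ y = (y^-1 * a) * (b * y))%g by rewrite conjgE !mulgA.
rewrite groupM//; apply: mem_gen; apply: mem_mulg => //.
  by rewrite -sym.
by rewrite sym.
by rewrite -sym.
Qed.

Lemma diff_gen_of_classes :
  union_of_classes Gam -> H = [set: gT]%SET :> {set gT}.
Proof.
case=> K [KC GK].
have GJ x y : x \in Gam -> (x ^ y)%g \in Gam.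
  rewrite GK => /bigcupP[B BK xB]; apply/bigcupP; exists B => //.
  have /imsetP[z _ Bz] := subsetP KC B BK.
  rewrite Bz in xB *; have /imsetP[t _ ->] := xB.
  by rewrite -conjgM; apply: imset_f; rewrite inE.
apply: diff_gen_of_norm; apply/subsetP => y yG.
apply/normP/eqP; rewrite eqEcard cardJg leqnn andbT -genJ gen_subG.
apply/subsetP => _ /imsetP[_ /mulsgP[a b aG bG ->] ->].
rewrite conjMg mem_gen// mem_mulg ?GJ//.
rewrite -memV_invg invgK in bG; rewrite -memV_invg invgK -conjVg GJ//.
Qed.

Lemma diff_gen_of_one : 1%g \in Gam -> H = [set: gT]%SET :> {set gT}.
Proof.
move=> G1; apply: diff_gen_of_supp; apply/subsetP => x xG.
by rewrite mem_gen// -[x]mulg1 mem_mulg// -invg1 memV_invg.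
Qed.
End Generation.

Lemma abelian_classes (gT : finGroupType) (A : {set gT}) :
  abelian [set: gT]%SET -> union_of_classes A.
Proof.
move=> ab; exists [set [set x]%SET | x in A]%SET; split.
  apply/subsetP => _ /imsetP[x xA ->]; apply/imsetP; exists x => //.
  by rewrite (abelian_classP _ ab).
rewrite cover_imset; apply/setP => x; apply/idP/bigcupP => [xA|[y yA]].
  by exists x => //; exact: set11.
by move=> /set1P ->.
Qed.

(** * Words with independent letters *)

Section WordContraction.
Variables (R : realType) (gT : finGroupType) (mu : gT -> R).
Hypothesis hmu : is_prob_mass mu.
Variable r : R.
Hypothesis r_ge0 : 0 <= r.
Hypothesis contract : forall f, \sum_x f x = 0 ->
  sqnorm (rconv mu f) <= r ^+ 2 * sqnorm f.
Variable m : nat.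
Local Notation Egrp := (pexp (fun _ : 'I_m.+1 => mu)).

Let mu0 (i : 'I_m.+1) x : 0 <= mu x. Proof. exact: mu_ge0. Qed.
Let mu1 (i : 'I_m.+1) : \sum_x mu x = 1. Proof. exact: mu_sum1. Qed.

(** The walk conditioned on the samples outside [A], which then act as group
    constants. *)
Section MixedWord.
Variables (A : {set 'I_m.+1}) (k : 'I_m.+1 -> gT).

Definition letter (g : {ffun 'I_m.+1 -> gT}) (i : 'I_m.+1) : gT :=
  if i \in A then g i else k i.

Definition mixed_word (n : nat) (g : {ffun 'I_m.+1 -> gT}) : gT :=
  (\prod_(0 <= i < n) letter g (inord i))%g.

Definition mixed_law (n : nat) (x : gT) : R :=
  Egrp (fun g => (mixed_word n g == x)%:R).

Lemma mixed_law_sum1 n : \sum_x mixed_law n x = 1.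
Proof.
rewrite -(pexp_sum _ (fun x g => (mixed_word n g == x)%:R)).
rewrite (eq_pexp _ (Psi := fun=> 1)) ?pexp_cst// => g.
rewrite (bigD1 (mixed_word n g))//= eqxx big1 ?addr0// => x /negbTE xn.
by rewrite eq_sym xn.
Qed.

Lemma mixed_lawS n x : (n < m.+1)%N -> mixed_law n.+1 x =
  if inord n \in A then rconv mu (mixed_law n) x
  else mixed_law n (x * (k (inord n))^-1)%g.
Proof.
move=> nm; have wS g : mixed_word n.+1 g =
    (mixed_word n g * letter g (inord n))%g by rewrite /mixed_word big_nat_recr.
have eqM (w y z : gT) : (w * y == z)%g = (w == z * y^-1)%g.
  by apply/eqP/eqP => [<-|->]; rewrite ?mulgK ?mulgKV.
rewrite /mixed_law; case: ifPn => nA; last first.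
  by apply: eq_pexp => g; rewrite wS /letter (negbTE nA) eqM.
rewrite (pexp_resample mu1 (inord n)) pexp_sum /rconv.
apply: eq_bigr => y _; rewrite pexpZ; congr (_ * _); apply: eq_pexp => g.
congr (_ %:R); rewrite wS /letter nA ffunE eqxx.
rewrite eqM; congr (_ == _ : nat).
apply: eq_big_nat => i /andP[_ ilt]; rewrite /letter.
case: ifP => // _; rewrite ffunE ifN//; apply/eqP => /(congr1 val) /=.
by rewrite !inordK// => [e|]; [rewrite e ltnn in ilt|exact: ltn_trans nm].
Qed.

(** Induction on the word: a random letter convolves the law with [mu] and a
    frozen one translates it, hence one factor [r] for each random letter. *)
Lemma mixed_law_sqnorm n : (n <= m.+1)%N ->
  sqnorm (fun x => mixed_law n x - #|gT|%:R^-1) <=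
  (\prod_(0 <= i < n) (if inord i \in A then r else 1)) ^+ 2.
Proof.
have N0 : #|gT|%:R != 0 :> R.
  by rewrite pnatr_eq0 -lt0n; apply/card_gt0P; exists 1%g.
have N1 : #|gT|%:R * #|gT|%:R^-1 = 1 :> R by rewrite divff.
elim: n => [_|n IH nm].
  rewrite big_geq// expr1n.
  have l0 x : mixed_law 0 x = (1%g == x)%:R.
    rewrite /mixed_law (eq_pexp _ (Psi := fun=> (1%g == x)%:R)) ?pexp_cst//.
    by move=> g; rewrite /mixed_word big_geq.
  rewrite /sqnorm (eq_bigr (fun x =>
    (1 - 2 * #|gT|%:R^-1) * (1%g == x)%:R + #|gT|%:R^-1 ^+ 2)); last first.
    by move=> x _; rewrite l0; case: eqP => _ /=; ring.
  rewrite big_split /= -mulr_sumr sumr_const (bigD1 1%g)//= eqxx.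
  rewrite big1; last first.
    by move=> x /negbTE; rewrite eq_sym => ->.
rewrite -[X in _ + X]mulr_natl addr0 mulr1 expr2 mulrA N1 mul1r.
  have : 0 <= #|gT|%:R^-1 :> R by rewrite invr_ge0.
  by move: (#|gT|%:R^-1 : R) => N; lra.
rewrite big_nat_recr//=; have {}IH := IH (ltnW nm).
case: (boolP (inord n \in A)) => nA.
  rewrite [leLHS](_ : _ =
    sqnorm (rconv mu (fun x => mixed_law n x - #|gT|%:R^-1))).
    apply: (le_trans (contract _)).
      rewrite sumrB mixed_law_sum1 sumr_const -[X in _ - X]mulr_natl N1.
      exact: subrr.
    by rewrite exprMn mulrC ler_wpM2r ?sqr_ge0.
  apply: eq_bigr => x _; rewrite mixed_lawS// nA /rconv.
  under [in RHS]eq_bigr do rewrite mulrBr.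
  by rewrite sumrB -mulr_suml (mu_sum1 hmu) mul1r.
rewrite mulr1; apply: le_trans IH; rewrite le_eqVlt; apply/orP; left; apply/eqP.
rewrite [RHS](reindex_inj (mulIg (k (inord n))^-1%g)).
by apply: eq_bigr => x _; rewrite mixed_lawS// (negbTE nA).
Qed.

Lemma mixed_law_dist x :
  `|mixed_law m.+1 x - #|gT|%:R^-1| <= \prod_i (if i \in A then r else 1).
Proof.
have := mixed_law_sqnorm (leqnn m.+1); rewrite big_mkord.
rewrite (eq_bigr (fun i => if i \in A then r else 1)); last first.
  by move=> i _; rewrite inord_val.
set q := \prod_i _ => h.
have q0 : 0 <= q by apply: prodr_ge0 => i _; case: ifP.
rewrite -(ler_pXn2r (n := 2))// ?nnegrE// real_normK ?num_real//.
apply: le_trans h; rewrite /sqnorm (bigD1 x)//= lerDl.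
by apply: sumr_ge0 => y _; exact: sqr_ge0.
Qed.

End MixedWord.

(** Here [F i] is the sample read at step [i], and the two hypotheses say that a
    sample with index in [A] is read at its own step only.  The bound holds
    conditionally on the samples outside [A], hence on average. *)
Lemma word_law_dist (F : 'I_m.+1 -> 'I_m.+1) (A : {set 'I_m.+1}) x :
  (forall i, i \in A -> F i = i) ->
  (forall j, F j \in A -> F j = j) ->
  `|Egrp (fun g => ((\prod_(i < m.+1) g (F i))%g == x)%:R) - #|gT|%:R^-1|
    <= \prod_(i < m.+1) (if i \in A then r else 1).
Proof.
move=> FA FnA; rewrite (pexp_splice mu1 A).
rewrite -[X in _ - X](pexp_cst mu1) -[X in _ - X]mul1r -mulNr -pexpZ -pexpD.
apply: (le_trans (norm_pexp mu0 _)).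
rewrite -[leRHS](pexp_cst mu1); apply: (le_pexp mu0) => g _.
rewrite mulN1r.
apply: le_trans (mixed_law_dist A (fun i => g (F i)) x).
rewrite le_eqVlt; apply/orP; left; apply/eqP; congr (`|_ - _|).
apply: eq_pexp => g'; congr ((_ == x)%:R).
rewrite /mixed_word big_mkord; apply: eq_bigr => i _.
rewrite inord_val ffunE /letter; case: (boolP (i \in A)) => iA.
  by rewrite (FA _ iA) iA.
by case: ifPn => // FiA; rewrite -(FnA _ FiA) FiA in iA.
Qed.
End WordContraction.

(** * Leaves of the random recursive tree *)

(** Index [i] stands for time [i + 1], so that [time_wt] is the law of the
    parent of a node in the random recursive tree with [m + 1] nodes.  The root
    has no parent: its weight is concentrated on the dummy value [ord0], which
    keeps the three noise families indexed by the same type. *)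
Section RecursiveTree.
Variables (R : realType) (m : nat).

Definition time_wt (i j : 'I_m.+1) : R :=
  if i == ord0 then (j == ord0)%:R else (j < i)%N%:R / i%:R.

Lemma time_wt_ge0 i j : 0 <= time_wt i j.
Proof. by rewrite /time_wt; case: ifP => _; rewrite ?divr_ge0 ?ler0n. Qed.

Lemma card_lt_ord (n : nat) : (n <= m.+1)%N ->
  #|[set j : 'I_m.+1 | (j < n)%N]%SET| = n.
Proof.
by move=> nm; rewrite -sum1dep_card (big_ord_narrow nm) sum1_card card_ord.
Qed.

Lemma time_wt_sum1 i : \sum_j time_wt i j = 1.
Proof.
rewrite /time_wt; case: (eqVneq i ord0) => [_|i0].
  rewrite (bigD1 ord0)//= big1 ?addr0// => j /negbTE j0.
  by rewrite j0.
have -> : \sum_(j < m.+1) ((j < i)%N%:R / i%:R) = i%:R / i%:R :> R.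
  rewrite -mulr_suml -natr_sum; congr (_%:R / _).
  rewrite -[RHS](card_lt_ord (ltnW (ltn_ord i))) -sum1dep_card [RHS]big_mkcond.
  by apply: eq_bigr => j _; case: (j < i)%N.
by rewrite divff// pnatr_eq0.
Qed.

Local Notation Etree := (pexp time_wt).

(** The leaves, other than the root, of the tree formed by the first [n] nodes.
    Only the parents of indices above [j] are inspected, so that [unref_upd]
    holds for every [v], even one in which some node points forward. *)
Definition unref (n : nat) (v : {ffun 'I_m.+1 -> 'I_m.+1}) : {set 'I_m.+1} :=
  [set j : 'I_m.+1 | (0 < j < n)%N &
    [forall k : 'I_m.+1, (j < k < n)%N ==> (v k != j)]]%SET.

Lemma unref_lt n v (j : 'I_m.+1) : j \in unref n v -> (j < n)%N.
Proof. by rewrite inE => /andP[/andP[]]. Qed.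

Lemma unref_upd (n : 'I_m.+1) v (j : 'I_m.+1) : (0 < n)%N -> (j < n)%N ->
  unref n.+1 (upd v n j) = ((n |: unref n v) :\ j)%SET.
Proof.
move=> n0 jn; apply/setP => i; rewrite !inE.
case: (eqVneq i j) => [->|ij] /=.
  rewrite ltnS ltnNge; apply/negbTE; rewrite negb_and; apply/orP; right.
  rewrite negb_forall; apply/existsP; exists n.
  by rewrite jn ltnSn /= ffunE eqxx negbK.
case: (eqVneq i n) => [->|ni] /=.
  rewrite n0 ltnSn /=; apply/forallP => k; apply/implyP; rewrite ltnS; lia.
have -> : (i < n.+1)%N = (i < n)%N.
  by rewrite ltnS leq_eqVlt (_ : (i == n :> nat) = false)//; apply/negbTE.
congr (_ && _); apply/forallP/forallP => H k; apply/implyP => /andP[ik kn].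
  have := H k; rewrite ik ltnS (ltnW kn) /= ffunE ifN//.
  by apply/eqP => kn'; rewrite kn' ltnn in kn.
rewrite ffunE; case: (eqVneq k n) => [_|kn']; first by rewrite eq_sym.
have := H k; rewrite ik /=; suff -> : (k < n)%N by [].
by rewrite ltn_neqAle kn' -ltnS.
Qed.

Lemma card_unref_upd (n : 'I_m.+1) v (j : 'I_m.+1) : (0 < n)%N -> (j < n)%N ->
  #|unref n.+1 (upd v n j)| = (#|unref n v| + (j \notin unref n v))%N.
Proof.
move=> n0 jn; rewrite unref_upd//.
have nU : n \notin unref n v by apply/negP => /unref_lt; rewrite ltnn.
have jn' : (j == n) = false.
  by apply/negbTE; apply/eqP => e; rewrite e ltnn in jn.
have := cardsD1 j (n |: unref n v)%SET; rewrite cardsU1 nU in_setU1 jn' /= => e.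
apply/eqP; rewrite -(eqn_add2l (j \in unref n v)) -e.
by case: (j \in unref n v); rewrite /= ?addn0 ?addn1 ?add0n ?add1n.
Qed.

(** The parent of the new node is uniform, and a leaf with conditional
    probability [#|unref n v| / n]. *)
Lemma Etree_step (n : 'I_m.+1) (h : nat -> R) : (0 < n)%N ->
  Etree (fun v => h #|unref n.+1 v|) =
  Etree (fun v => #|unref n v|%:R / n%:R * h #|unref n v| +
     (1 - #|unref n v|%:R / n%:R) * h #|unref n v|.+1).
Proof.
move=> n0; rewrite (pexp_resample time_wt_sum1 n).
apply: eq_pexp => v; set U := unref n v.
have n0' : n != ord0 by rewrite -lt0n.
have nR : n%:R != 0 :> R by rewrite pnatr_eq0.
have UL : U \subset [set j : 'I_m.+1 | (j < n)%N]%SET.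
  by apply/subsetP => j /unref_lt; rewrite inE.
transitivity (\sum_(j in [set j : 'I_m.+1 | (j < n)%N]%SET)
    n%:R^-1 * h (#|U| + (j \notin U))%N).
  rewrite [RHS]big_mkcond; apply: eq_bigr => j _.
  rewrite inE /time_wt (negbTE n0').
  by case: ifP => jn; rewrite ?mul0r// mul1r card_unref_upd.
rewrite (big_setID U) /= (finset.setIidPr UL).
rewrite (eq_bigr (fun=> n%:R^-1 * h #|U|)); last by move=> j ->; rewrite addn0.
rewrite [X in _ + X](eq_bigr (fun=> n%:R^-1 * h #|U|.+1)); last first.
  by move=> j; rewrite inE => /andP[-> _]; rewrite addn1.
rewrite !sumr_const cardsD (finset.setIidPr UL).
rewrite card_lt_ord ?(ltnW (ltn_ord n))//.
have Un : (#|U| <= n)%N.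
  rewrite -[leqRHS](@card_lt_ord n) ?(ltnW (ltn_ord n))//.
  exact: subset_leq_card.
by rewrite -[X in X + _]mulr_natl -[X in _ + X]mulr_natl natrB//; field.
Qed.

Lemma unref1 v : unref 1 v = set0.
Proof. by apply/setP => j; rewrite !inE; case: (j : nat). Qed.

(** The exact mean is half the number of nodes from two nodes on; a single node
    is the root, which does not count as a leaf. *)
Lemma Etree_leaves (n : nat) : (n <= m)%N ->
  Etree (fun v => #|unref n.+1 v|%:R) <= n.+1%:R / 2.
Proof.
elim: n => [_|n IH nm].
  rewrite (eq_pexp _ (Psi := fun=> 0)) => [|v]; last by rewrite unref1 cards0.
  by rewrite (pexp_cst time_wt_sum1); lra.
have nm' : (n.+1 < m.+1)%N by [].
have /= -> := @Etree_step (Ordinal nm') (fun l => l%:R) isT.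
have nR : n.+1%:R != 0 :> R by rewrite pnatr_eq0.
have n1 : 0 <= 1 - n.+1%:R^-1 :> R by rewrite subr_ge0 invf_le1// ler1n.
rewrite (eq_pexp _ (Psi := fun v =>
    (1 - n.+1%:R^-1) * #|unref n.+1 v|%:R + 1)); last first.
  by move=> v; rewrite -[#|_|.+1]addn1 natrD; field.
rewrite pexpD pexpZ (pexp_cst time_wt_sum1).
apply: (@le_trans _ _ ((1 - n.+1%:R^-1) * (n.+1%:R / 2) + 1)).
  by rewrite lerD2r ler_wpM2l// IH// ltnW.
rewrite le_eqVlt; apply/orP; left; apply/eqP.
by rewrite -[n.+2]addn1 natrD; field.
Qed.

(** Negative correlation is obtained by comparing [s ^+ L] with the constant
    [kap = s ^+ (n.+1)./2]: the difference [s ^+ L - kap] and the deviation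
    [w = L - n.+1 / 2] have opposite signs, and [w] has nonpositive mean. *)
Lemma Etree_pow (s : R) (n : nat) : 0 <= s -> s <= 1 -> (n <= m)%N ->
  Etree (fun v => s ^+ #|unref n.+1 v|) <= ((1 + s) / 2) ^+ n.
Proof.
move=> s0 s1; elim: n => [_|n IH nm].
  rewrite (eq_pexp _ (Psi := fun=> 1)) => [|v]; last by rewrite unref1 cards0.
  by rewrite (pexp_cst time_wt_sum1) expr0.
have nm' : (n.+1 < m.+1)%N by [].
have /= -> := @Etree_step (Ordinal nm') (fun l => s ^+ l) isT.
have nR : 0 < n.+1%:R :> R by rewrite ltr0n.
pose kap := s ^+ (n.+1)./2.
have kap0 : 0 <= kap by exact: exprn_ge0.
pose w v : R := #|unref n.+1 v|%:R - n.+1%:R / 2.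
have corr : Etree (fun v => s ^+ #|unref n.+1 v| * w v) <= 0.
  apply: (@le_trans _ _ (Etree (fun v => kap * w v))).
    apply: (le_pexp time_wt_ge0) => v _.
    rewrite /w /kap; set l := #|_|.
    have [lh|hl] := leqP l (n.+1)./2.
      have : s ^+ (n.+1)./2 <= s ^+ l by exact: ler_wiXn2l.
      have : l%:R <= n.+1%:R / 2 :> R.
        by rewrite ler_pdivlMr// -natrM ler_nat; lia.
      nra.
    have : s ^+ l <= s ^+ (n.+1)./2 by apply: ler_wiXn2l => //; exact: ltnW.
    have : n.+1%:R / 2 <= l%:R :> R.
      by rewrite ler_pdivrMr// -natrM ler_nat; lia.
    nra.
  rewrite pexpZ pexpD (pexp_cst time_wt_sum1) mulr_ge0_le0//.
  by rewrite subr_le0 Etree_leaves// ltnW.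
rewrite (eq_pexp _ (Psi := fun v => (1 + s) / 2 * s ^+ #|unref n.+1 v| +
   (1 - s) / n.+1%:R * (s ^+ #|unref n.+1 v| * w v))); last first.
  by move=> v; rewrite /w exprS; field; rewrite gt_eqF.
rewrite pexpD !pexpZ exprS.
apply: (@le_trans _ _ ((1 + s) / 2 * Etree (fun v => s ^+ #|unref n.+1 v|))).
  by rewrite gerDl mulr_ge0_le0// divr_ge0 ?subr_ge0// ltW.
by apply: ler_wpM2l; [lra|apply: IH; exact: ltnW].
Qed.

End RecursiveTree.

(** * From coins and times to words in the samples *)

Section Genealogy.
Variables (m : nat).
Variables (c : {ffun 'I_m.+1 -> bool}) (v : {ffun 'I_m.+1 -> 'I_m.+1}).

Definition parent (i : 'I_m.+1) : 'I_m.+1 := if c i then v i else i.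

(** The index of the sample read at step [i].  Going to the parent decreases
    the index until a fresh step is met, so [m.+1] iterations reach the fixed
    point. *)
Definition origin (i : 'I_m.+1) : 'I_m.+1 := iter m.+1 parent i.

Hypothesis v_le : forall i, (v i <= i)%N.

Lemma origin_parent i : origin (parent i) = origin i.
Proof.
have H n (j : 'I_m.+1) : parent (iter n parent j) = iter n parent j \/
    (iter n parent j + n <= j)%N.
  elim: n => [|n [e|lt]]; first by right; rewrite addn0.
    by left; rewrite /= e.
  rewrite /=; set k := iter n parent j in lt *.
  case: (eqVneq (parent k) k) => [e|ne]; first by left; rewrite !e.
  right; rewrite addnS -addSn; apply: leq_trans lt; rewrite leq_add2r.
  move: ne; rewrite /parent; case: (c k); rewrite ?eqxx//.
  by rewrite ltn_neqAle v_le andbT.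
rewrite /origin -iterSr /=; case: (H m.+1 i) => //= lt.
by have := ltn_ord i; rewrite ltnNge (leq_trans _ lt)// leq_addl.
Qed.

(** The fresh steps that no later time points at, which are therefore the only
    readers of their sample. *)
Definition solitary : {set 'I_m.+1} := [set i in unref m.+1 v | ~~ c i]%SET.

Lemma origin_solitary i : i \in solitary -> origin i = i.
Proof.
rewrite !inE => /andP[_ /negbTE ci]; rewrite /origin; apply: iter_fix.
by rewrite /parent ci.
Qed.

Lemma solitary_origin j : origin j \in solitary -> origin j = j.
Proof.
suff H n : iter n parent j \in solitary -> iter n parent j = j by exact: H.
elim: n => //= n IH; set k := iter n parent j.
have pk : parent k \in solitary -> parent k = k.
  rewrite {2}/parent; case ck: (c k) => //; rewrite /parent ck.
  rewrite !inE => /andP[/andP[_ /forallP/(_ k)]]; rewrite eqxx implybF.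
  rewrite ltn_ord andbT -leqNgt => kv cv.
  rewrite (_ : v k = k) ?ck// in cv *.
  by apply/val_inj/eqP; rewrite eqn_leq v_le.
move=> h; have e := pk h; rewrite e; apply: IH; by rewrite -/k -e.
Qed.
End Genealogy.

Definition word (gT : finGroupType) m (c : {ffun 'I_m.+1 -> bool})
    (v : {ffun 'I_m.+1 -> 'I_m.+1}) (g : {ffun 'I_m.+1 -> gT}) : gT :=
  (\prod_(i < m.+1) g (origin c v i))%g.

Section Coins.
Variables (R : realType) (m : nat) (al : R).
Hypotheses (al0 : 0 <= al) (al1 : al < 1).

(** As for [time_wt], index [ord0] carries a dummy value. *)
Definition coin_wt (i : 'I_m.+1) (b : bool) : R :=
  if i == ord0 then (~~ b)%:R else if b then al else 1 - al.

Lemma coin_wt_ge0 i b : 0 <= coin_wt i b.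
Proof.
by rewrite /coin_wt; case: ifP; case: b => // _; rewrite subr_ge0 ltW.
Qed.

Lemma coin_wt_sum1 i : \sum_b coin_wt i b = 1.
Proof. by rewrite big_bool /coin_wt; case: ifP => _ /=; ring. Qed.

(** The coins are independent, so the mean of the product is a product of means:
    each index of [U] contributes [al + (1 - al) * r], the others 1. *)
Lemma coin_average (r : R) (U : {set 'I_m.+1}) : ord0 \notin U ->
  pexp coin_wt (fun c =>
    \prod_(i < m.+1) (if i \in [set i in U | ~~ c i]%SET then r else 1)) =
  (al + (1 - al) * r) ^+ #|U|.
Proof.
move=> U0.
transitivity (pexp coin_wt (fun c =>
    \prod_(i < m.+1) (if (i \in U) && ~~ c i then r else 1))).
  by apply: eq_pexp => c; apply: eq_bigr => i _; rewrite inE.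
rewrite (pexp_prod _ (fun i b => if (i \in U) && ~~ b then r else 1)).
rewrite -prodr_const [RHS]big_mkcond; apply: eq_bigr => i _.
rewrite big_bool /=; case: (boolP (i \in U)) => iU /=.
  have i0 : (i == ord0) = false.
    by apply/negP => /eqP e; rewrite -e iU in U0.
  by rewrite /coin_wt i0; ring.
by have := coin_wt_sum1 i; rewrite big_bool /= !mulr1.
Qed.
End Coins.

(** * The law of the walk *)

Section MixedBound.
Variables (R : realType) (gT : finGroupType) (mu : gT -> R).
Hypothesis hmu : is_prob_mass mu.
Variable r : R.
Hypotheses (r_ge0 : 0 <= r) (r_lt1 : r < 1).
Hypothesis contract : forall f, \sum_x f x = 0 ->
  sqnorm (rconv mu f) <= r ^+ 2 * sqnorm f.
Variables (m : nat) (al : R).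
Hypotheses (al0 : 0 <= al) (al1 : al < 1).

Definition config_law (x : gT) : R :=
  pexp (@time_wt R m) (fun v => pexp (@coin_wt R m al) (fun c =>
    pexp (fun _ : 'I_m.+1 => mu) (fun g => (word c v g == x)%:R))).

Lemma config_law_dist x : `|config_law x - #|gT|%:R^-1| <=
  ((1 + (al + (1 - al) * r)) / 2) ^+ m.
Proof.
set s := al + (1 - al) * r.
have s0 : 0 <= s by rewrite addr_ge0 ?mulr_ge0// subr_ge0 ltW.
have s1 : s <= 1.
  have : 0 <= (1 - al) * (1 - r) by rewrite mulr_ge0 ?subr_ge0 ?ltW.
  by rewrite /s; lra.
have c0 := coin_wt_ge0 al0 al1 (m := m); have c1 := @coin_wt_sum1 R m al.
have t0 := @time_wt_ge0 R m; have t1 := @time_wt_sum1 R m.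
have subE (I T : finType) (p : I -> T -> R) (p1 : forall i, \sum_t p i t = 1)
    Phi a : pexp p Phi - a = pexp p (fun f => Phi f - a).
  by rewrite pexpD (pexp_cst p1).
apply: le_trans (Etree_pow s0 s1 (leqnn m)).
rewrite /config_law subE//; apply: (le_trans (norm_pexp t0 _)).
apply: (le_pexp t0) => v vt.
have v_le i : (v i <= i)%N.
  have := vt i; rewrite /time_wt; case: (eqVneq i ord0) => [->|_].
    by case: (eqVneq (v ord0) ord0) => [->|]; rewrite ?eqxx.
  by case: ltnP => [/ltnW//|]; rewrite mul0r eqxx.
have U0 : ord0 \notin unref m.+1 v by rewrite inE.
rewrite -(coin_average al r U0) subE//; apply: (le_trans (norm_pexp c0 _)).
apply: (le_pexp c0) => c _.
apply: (word_law_dist hmu r_ge0 contract) => [i|j].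
  exact: origin_solitary.
exact: solitary_origin.
Qed.
End MixedBound.

Section NoiseConfigurations.
Context (R : realType) (d : measure_display) (Om : measurableType d)
  (P : probability Om R) (gT : finGroupType) (mu : gT -> R) (al : R).
Variables (xi : nat -> Om -> bool) (u : nat -> Om -> nat)
  (eta X S : nat -> Om -> gT).
Hypothesis HS : is_SRRW_from P mu al xi u eta X S.
Variable m : nat.

(** The noise read by the first [m.+1] steps, as finite functions; index [i]
    stands for time [i + 1]. *)
Definition coins w : {ffun 'I_m.+1 -> bool} :=
  [ffun i : 'I_m.+1 => if i == ord0 then false else xi i.+1 w].
Definition times w : {ffun 'I_m.+1 -> 'I_m.+1} :=
  [ffun i : 'I_m.+1 => if i == ord0 then ord0 else inord (u i.+1 w).-1].
Definition samples w : {ffun 'I_m.+1 -> gT} := [ffun i : 'I_m.+1 => eta i.+1 w].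

Lemma times_val w (i : 'I_m.+1) : i != ord0 ->
  (times w i).+1 = u i.+1 w /\ (times w i < i)%N.
Proof.
move=> i0; have ip : (1 < i.+1)%N by rewrite ltnS lt0n.
have /andP[u1 ui] := time_range HS w ip.
have ui' : ((u i.+1 w).-1 < i)%N by rewrite -ltnS prednK.
by rewrite ffunE (negbTE i0) inordK; [rewrite prednK|exact: ltn_trans ui' _].
Qed.

Lemma times_le w (i : 'I_m.+1) : (times w i <= i)%N.
Proof.
case: (eqVneq i ord0) => [->|i0]; first by rewrite ffunE.
by have [_ /ltnW] := times_val w i0.
Qed.

Lemma step_origin w (i : 'I_m.+1) :
  X i.+1 w = samples w (origin (coins w) (times w) i).
Proof.
have [n] := ubnP (nat_of_ord i); elim: n i => // n IH i ilt.
have fixed j : coins w j = false -> origin (coins w) (times w) j = j.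
  by move=> cj; rewrite /origin iter_fix// /parent cj.
case: (eqVneq i ord0) => [->|i0].
  by rewrite fixed ?ffunE//; exact: (first_step HS).
have ip : (1 < i.+1)%N by rewrite ltnS lt0n.
have ci : coins w i = xi i.+1 w by rewrite ffunE (negbTE i0).
rewrite (next_step HS w ip) -ci; case ciw: (coins w i); last first.
  by rewrite fixed// ffunE.
have [<- lt] := times_val w i0.
rewrite -(origin_parent (coins w) (times_le w)) /parent ciw.
by apply: IH; rewrite (leq_trans lt).
Qed.

Lemma walk_word w : S m.+1 w = word (coins w) (times w) (samples w).
Proof.
have H n : S n w = (\prod_(0 <= i < n) X i.+1 w)%g.
  elim: n => [|n IH]; first by rewrite (walk_start HS) big_geq.
  by rewrite (walk_step HS) IH big_nat_recr.
by rewrite H big_mkord /word; apply: eq_bigr => i _; exact: step_origin.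
Qed.

Local Notation config := ({ffun 'I_m.+1 -> bool} *
  {ffun 'I_m.+1 -> 'I_m.+1} * {ffun 'I_m.+1 -> gT})%type.

Definition cyl (q : config) : set Om :=
  [set w | (coins w, times w, samples w) = q]%classic.

(* The noise variables that determine [cyl q], and their values there.  Times
   count from 1 and indices from 0, hence the successor on the values of [u]. *)
Let idx : seq (nat + nat + nat) :=
  [seq inl (inl k) | k <- iota 0 m] ++ [seq inl (inr k) | k <- iota 0 m] ++
  [seq inr k | k <- iota 0 m.+1].

Let val_at (q : config) (i : nat + nat + nat) : set (noise_val gT i) :=
  match i with
  | inl (inl k) => [set q.1.1 (inord k.+1 : 'I_m.+1)]%classic
  | inl (inr k) => [set (q.1.2 (inord k.+1 : 'I_m.+1) : 'I_m.+1).+1]%classic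
  | inr k => [set q.2 (inord k : 'I_m.+1)]%classic
  end.

Lemma inord_neq0 k : (k < m)%N -> inord k.+1 != ord0 :> 'I_m.+1.
Proof. by move=> km; apply/eqP => /(congr1 val); rewrite /= inordK. Qed.

(** The dummy coordinates are not noise variables, so the intersection describes
    [cyl q] only when [q] has the right values there. *)
Lemma cylE (q : config) : q.1.1 ord0 = false -> q.1.2 ord0 = ord0 ->
  cyl q =
  (\bigcap_(i in [set` idx]) (noise xi u eta i @^-1` @val_at q i))%classic.
Proof.
case: q => -[c v] g /= c0 v0; apply/seteqP; split=> w.
  case=> <- <- <- i /=; rewrite !mem_cat => /orP[|/orP[]] /mapP[k].
  - rewrite mem_iota => /andP[_ km] -> /=; rewrite ffunE.
    by rewrite ifN ?inord_neq0// inordK.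
  - rewrite mem_iota => /andP[_ km] -> /=.
    by have [-> _] := times_val w (inord_neq0 km); rewrite inordK.
  - by rewrite mem_iota => /andP[_ km] -> /=; rewrite ffunE inordK.
move=> H.
have Hc k : (k < m)%N -> xi k.+2 w = c (inord k.+1).
  move=> km; apply: (H (inl (inl k))) => /=.
  by rewrite mem_cat map_f// mem_iota.
have Hv k : (k < m)%N -> u k.+2 w = (v (inord k.+1)).+1.
  move=> km; apply: (H (inl (inr k))) => /=.
  by rewrite !mem_cat (map_f (fun k => inl (inr k))) ?orbT// mem_iota.
have Hg k : (k < m.+1)%N -> eta k.+1 w = g (inord k).
  move=> km; apply: (H (inr k)) => /=.
  by rewrite !mem_cat (map_f inr) ?orbT// mem_iota.
have pos (i : 'I_m.+1) : i != ord0 -> exists2 k, (k < m)%N & i = inord k.+1.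
  have ilt := ltn_ord i; move=> i0; have ip : (0 < i)%N by rewrite lt0n.
  exists i.-1; first by lia.
  by rewrite prednK ?lt0n// inord_val.
congr (_, _, _); apply/ffunP => i; rewrite ffunE.
- case: (eqVneq i ord0) => [->//|/pos[k km ->]].
  by rewrite inordK// Hc.
- case: (eqVneq i ord0) => [->//|/pos[k km ->]].
  have -> : u (inord k.+1 : 'I_m.+1).+1 w = (v (inord k.+1)).+1.
    by rewrite inordK// Hv.
  by rewrite inord_val.
- by rewrite Hg ?inord_val.
Qed.

Lemma idx_uniq : uniq idx.
Proof.
have inj (f : nat -> nat + nat + nat) n :
  injective f -> uniq (map f (iota 0 n)).
  by move=> fI; rewrite map_inj_uniq ?iota_uniq.
rewrite cat_uniq cat_uniq !inj ?andbT ?andTb; try by move=> a b [].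
apply/andP; split; apply/hasPn => i.
  by rewrite mem_cat => /orP[] /mapP[k _ ->]; apply/mapP => -[].
by move=> /mapP[k _ ->]; apply/mapP => -[].
Qed.

Lemma measurable_noise i (A : set (noise_val gT i)) :
  measurable (noise xi u eta i @^-1` A)%classic.
Proof.
case: i A => [[k|k]|k] A.
- exact: (coin_rv HS).
- exact: (time_rv HS).
- exact: (fresh_rv HS).
Qed.

Lemma prob_coin k b : P [set w | xi k.+2 w = b]%classic =
  (if b then al else 1 - al)%:E.
Proof.
case: b; first exact: (coin_law HS).
rewrite (_ : [set w | _]%classic = (~` [set w | xi k.+2 w = true])%classic).
  rewrite probability_setC ?(coin_law HS) ?EFinB//.
  exact: (coin_rv HS (n := k.+2) isT [set true]%classic).
by apply/seteqP; split=> w /=; case: (xi _ _).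
Qed.

Lemma prob_time (i j : 'I_m.+1) : i != ord0 ->
  P [set w | u i.+1 w = j.+1]%classic = (time_wt R i j)%:E.
Proof.
move=> i0; have ip : (1 < i.+1)%N by rewrite ltnS lt0n.
rewrite /time_wt (negbTE i0); case: ltnP => ji.
  by rewrite (time_law HS)// mul1r.
rewrite mul0r (_ : [set w | _]%classic = classical_sets.set0) ?measure0//.
apply/seteqP; split=> w //= e; have := time_range HS w ip.
by rewrite e; lia.
Qed.

Lemma cyl_empty (q : config) :
  ~~ (~~ q.1.1 ord0 && (q.1.2 ord0 == ord0)) -> cyl q = classical_sets.set0.
Proof.
move=> ne; apply/seteqP; split=> w //= e.
by rewrite -e !ffunE eqxx in ne.
Qed.

Lemma prob_cyl (q : config) : P (cyl q) =
  ((\prod_i coin_wt al i (q.1.1 i)) * (\prod_i time_wt R i (q.1.2 i)) *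
   (\prod_i mu (q.2 i)))%:E.
Proof.
case: (boolP (~~ q.1.1 ord0 && (q.1.2 ord0 == ord0))) => [|ne]; last first.
  rewrite cyl_empty// measure0 [X in X * _ * _]big_ord_recl.
  rewrite [X in _ * X * _]big_ord_recl /coin_wt /time_wt !eqxx.
  move: ne; rewrite negb_and => /orP[/negbTE ->|/negbTE ->].
    by rewrite !mul0r.
  by rewrite mul0r mulr0 mul0r.
case/andP=> /negbTE c0 /eqP v0.
rewrite cylE// (noise_indep HS _ idx_uniq) !big_cat !big_map /=.
rewrite !EFinM -!prodEFin muleA; congr (_ * _ * _)%E.
- rewrite big_ord_recl {1}/coin_wt eqxx c0 mul1e -[m in iota _ m]subn0.
  rewrite -/(index_iota 0 m) big_mkord; apply: eq_bigr => k _.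
  have e : inord k.+1 = lift ord0 k.
    by apply: val_inj; rewrite /= inordK ?ltnS ?ltn_ord.
  by rewrite [LHS]prob_coin e /coin_wt.
- rewrite big_ord_recl {1}/time_wt eqxx v0 eqxx mul1e -[m in iota _ m]subn0.
  rewrite -/(index_iota 0 m) big_mkord; apply: eq_bigr => k _.
  have e : inord k.+1 = lift ord0 k.
    by apply: val_inj; rewrite /= inordK ?ltnS ?ltn_ord.
  by rewrite e; exact: (@prob_time (lift ord0 k)).
- rewrite -[_ :: _]/(index_iota 0 m.+1) big_mkord.
  by apply: eq_bigr => k _; rewrite inord_val; exact: (fresh_law HS).
Qed.

(** The events [cyl q] partition the sample space, and [walk_word] makes the
    walk constant on each of them. *)
Lemma prob_walk x : fine (P [set w | S m.+1 w = x]%classic) =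
  config_law mu m al x.
Proof.
pose D (q : config) := word q.1.1 q.1.2 q.2 == x.
pose s := [seq q <- index_enum _ | D q].
have -> : [set w | S m.+1 w = x]%classic =
    (\bigcup_(q in [set` s]) cyl q)%classic.
  apply/seteqP; split=> w /=.
    move=> Sx; exists (coins w, times w, samples w) => //=.
    by rewrite mem_filter mem_index_enum /D /= -walk_word Sx eqxx.
  by case=> q /=; rewrite mem_filter => /andP[/eqP <- _] <-; exact: walk_word.
have mcyl (q : config) : measurable (cyl q).
  case: (boolP (~~ q.1.1 ord0 && (q.1.2 ord0 == ord0))) => [|ne]; last first.
    by rewrite cyl_empty// measurable0.
  case/andP=> /negbTE c0 /eqP v0.
  rewrite cylE//; apply: fin_bigcap_measurable => // i _.
  exact: measurable_noise.
rewrite measure_fin_bigcup//; last first.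
  by move=> q q' _ _ [w []]; rewrite /cyl /= => <- <-.
rewrite -fsbig_seq ?filter_uniq ?index_enum_uniq// big_filter.
rewrite (eq_bigr _ (fun q _ => prob_cyl q)) sumEFin /=.
rewrite /config_law /pexp.
transitivity (\sum_(c : {ffun 'I_m.+1 -> bool})
   \sum_(v : {ffun 'I_m.+1 -> 'I_m.+1}) \sum_(g : {ffun 'I_m.+1 -> gT})
   (\prod_i coin_wt al i (c i)) * (\prod_i time_wt R i (v i)) *
   (\prod_i mu (g i)) * (word c v g == x)%:R).
  rewrite !pair_bigA big_mkcond; apply: eq_bigr => -[[c v] g] _ /=.
  by rewrite /D /=; case: eqP; rewrite ?mulr1 ?mulr0.
rewrite exchange_big; apply: eq_bigr => v _; rewrite mulr_sumr.
apply: eq_bigr => c _; rewrite !mulr_sumr; apply: eq_bigr => g _.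
by ring.
Qed.
End NoiseConfigurations.

(** * The exponential bound *)

(** At time [m.+1] the tree has [m.+1] nodes, but the bound on its leaves only
    has exponent [m]; the factor [expR b] in the constant makes up for the
    missing step, uniformly in [al]. *)
Lemma SRRW_bound_of_diff_gen (R : realType) (gT : finGroupType) (mu : gT -> R) :
  is_prob_mass mu ->
  <<pmf_supp mu * (pmf_supp mu)^-1>>%g = [set: gT]%SET ->
  SRRW_exponential_bound mu.
Proof.
move=> hmu gen; have [r [r0 r1 contract]] := rconv_contraction hmu gen.
have N0 : 0 < #|gT|%:R :> R by rewrite ltr0n; apply/card_gt0P; exists 1%g.
pose b : R := (1 - r) / 2.
have b0 : 0 < b by rewrite divr_gt0// subr_gt0.
exists (#|gT|%:R * expR b), (expR (- b)); split.
- by rewrite mulr_gt0 ?expR_gt0.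
- exact: expR_gt0.
- by rewrite expR_lt1 oppr_lt0.
move=> al al0 al1 d Om P S [xi [u [eta [X HS]]]] [//|m] _.
have t0 : 0 <= (1 + (al + (1 - al) * r)) / 2.
  by rewrite divr_ge0// !addr_ge0// mulr_ge0// subr_ge0 ltW.
have decay : ((1 + (al + (1 - al) * r)) / 2) ^+ m <=
    expR b * expR (- b) `^ ((1 - al) * m.+1%:R).
  rewrite -expRM -expRD.
  apply: (@le_trans _ _ (expR (- ((1 - al) * b)) ^+ m)).
    apply: lerXn2r; rewrite ?nnegrE ?expR_ge0//.
    apply: le_trans (expR_ge1Dx _); rewrite /b; lra.
  rewrite -expRM_natl ler_expR -natr1.
  have : 0 <= al * b by rewrite mulr_ge0// ltW.
  by move: (m%:R : R) => M; lra.
apply: bigmax_le => [|x _].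
  by rewrite !mulr_ge0 ?powR_ge0 ?expR_ge0// ltW.
have N1 : #|gT|%:R / #|gT|%:R = 1 :> R by rewrite divff// gt_eqF.
rewrite (prob_walk HS) -[X in _ - X]N1 -mulrBr normrM gtr0_norm//.
rewrite -mulrA ler_pM2l//.
apply: le_trans decay; exact: (config_law_dist hmu r0 r1 contract).
Qed.

Theorem theorem1p6 (R : realType) (gT : finGroupType) (hG : (2 <= #|gT|)%N)
    (mu : gT -> R) (hmu : is_prob_mass mu)
    (hirr : irreducible_chain (transition_mx mu))
    (haper : aperiodic_chain (transition_mx mu)) :
  let Gam := pmf_supp mu in
  [/\ (<<Gam * Gam^-1>>%g = [set: gT]%SET -> SRRW_exponential_bound mu),
      (Gam = Gam^-1%g -> SRRW_exponential_bound mu),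
      (union_of_classes Gam -> SRRW_exponential_bound mu),
      (abelian [set: gT]%SET -> union_of_classes Gam) &
      (1%g \in Gam -> SRRW_exponential_bound mu)].
Proof.
move=> Gam; have bound := SRRW_bound_of_diff_gen hmu.
have mu0 := mu_ge0 hmu.
split=> // [sym|cls|ab|one].
- exact/bound/(diff_gen_of_symmetric mu0 hirr haper).
- exact/bound/(diff_gen_of_classes mu0 hirr haper).
- exact: abelian_classes.
- exact/bound/(diff_gen_of_one mu0 hirr).
Qed.
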